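(* Let $A,B\in\mathcal M_n$ be accretive with $W(A),W(B)\subset S_\alpha$ for some $0\le\alpha<\pi/2$. Then $$\cos^3(\alpha)\,\Re\big[(A\nabla B)\sharp(A!B)\big]\le \Re(A\sharp B)\le \sec^2(\alpha)\,\Re\big[(A\nabla B)\sharp(A!B)\big].$$
   Context: A matrix $A$ is accretive if $\Re A=\frac{A+A^*}{2}$ is positive definite. $W(A)=\{\langle Ax,x\rangle:\|x\|=1\}$ is the numerical range, and $S_\alpha=\{z\in\mathbb C:\Re z>0,\ |\Im z|\le\tan(\alpha)\Re z\}$. For Hermitian $X,Y$, $X\le Y$ means $Y-X$ is positive semidefinite. For accretive $A,B$: $A\nabla B=\frac{A+B}{2}$, $A!B=\big(\frac{A^{-1}+B^{-1}}{2}\big)^{-1}$, and $A\sharp B=A\sharp_{1/2}B$ where $A\sharp_\lambda B=\frac{\sin(\lambda\pi)}{\pi}\int_0^\infty t^{\lambda-1}(A^{-1}+tB^{-1})^{-1}dt$. *)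

(* Defs.v *)
(* complex numbers as pairs of Stdlib reals, n x n complex
   matrices as functions nat -> nat -> C (only indices < n are meaningful). *)
From Stdlib Require Import Reals Lra List ClassicalEpsilon.
Open Scope R_scope.

Definition C : Type := (R * R)%type.
Definition Cre (z : C) : R := fst z.
Definition Cim (z : C) : R := snd z.
Definition C0 : C := (0, 0).
Definition C1 : C := (1, 0).
Definition Cadd (z w : C) : C := (fst z + fst w, snd z + snd w).
Definition Copp (z : C) : C := (- fst z, - snd z).
Definition Cmul (z w : C) : C :=
  (fst z * fst w - snd z * snd w, fst z * snd w + snd z * fst w).
Definition Cconj (z : C) : C := (fst z, - snd z).
Definition CscalR (r : R) (z : C) : C := (r * fst z, r * snd z).

Definition Csum (n : nat) (f : nat -> C) : C :=
  fold_right (fun k acc => Cadd (f k) acc) C0 (seq 0 n).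

Definition Mat : Type := nat -> nat -> C.
Definition Vec : Type := nat -> C.

Definition mzero : Mat := fun _ _ => C0.
Definition mid : Mat := fun i j => if Nat.eq_dec i j then C1 else C0.
Definition madd (A B : Mat) : Mat := fun i j => Cadd (A i j) (B i j).
Definition msub (A B : Mat) : Mat := fun i j => Cadd (A i j) (Copp (B i j)).
Definition mscalR (r : R) (A : Mat) : Mat := fun i j => CscalR r (A i j).
Definition madj (A : Mat) : Mat := fun i j => Cconj (A j i).
Definition mmul (n : nat) (A B : Mat) : Mat :=
  fun i j => Csum n (fun k => Cmul (A i k) (B k j)).

Definition meq (n : nat) (A B : Mat) : Prop :=
  forall i j, (i < n)%nat -> (j < n)%nat -> A i j = B i j.

Definition is_inverse (n : nat) (A X : Mat) : Prop :=
  meq n (mmul n A X) mid /\ meq n (mmul n X A) mid.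

(* the inverse A^{-1} (chosen; unique on indices < n when A is invertible) *)
Definition minv (n : nat) (A : Mat) : Mat :=
  epsilon (inhabits mzero) (is_inverse n A).

Definition mvmul (n : nat) (A : Mat) (x : Vec) : Vec :=
  fun i => Csum n (fun k => Cmul (A i k) (x k)).

Definition cinner (n : nat) (u v : Vec) : C :=
  Csum n (fun i => Cmul (u i) (Cconj (v i))).

Definition vnonzero (n : nat) (x : Vec) : Prop :=
  exists i, (i < n)%nat /\ x i <> C0.

Definition ReM (A : Mat) : Mat := mscalR (1/2) (madd A (madj A)).

Definition hermitian (n : nat) (H : Mat) : Prop := meq n H (madj H).

Definition psd (n : nat) (H : Mat) : Prop :=
  hermitian n H /\ forall x : Vec, 0 <= Cre (cinner n (mvmul n H x) x).

Definition pd (n : nat) (H : Mat) : Prop :=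
  hermitian n H /\
  forall x : Vec, vnonzero n x -> 0 < Cre (cinner n (mvmul n H x) x).

Definition loewner_le (n : nat) (X Y : Mat) : Prop := psd n (msub Y X).

Definition accretive (n : nat) (A : Mat) : Prop := pd n (ReM A).

Definition numrange_sub (n : nat) (A : Mat) (S : C -> Prop) : Prop :=
  forall x : Vec, Cre (cinner n x x) = 1 -> S (cinner n (mvmul n A x) x).

Definition sector (alpha : R) (z : C) : Prop :=
  0 < Cre z /\ Rabs (Cim z) <= tan alpha * Cre z.

Definition mamean (A B : Mat) : Mat := mscalR (1/2) (madd A B).
Definition mhmean (n : nat) (A B : Mat) : Mat :=
  minv n (mscalR (1/2) (madd (minv n A) (minv n B))).

Definition improper_int_0_inf (f : R -> R) (l : R) : Prop :=
  forall eps, 0 < eps -> exists d M, 0 < d /\ 0 < M /\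
    forall a b, 0 < a -> a < d -> M < b ->
      exists pr : Riemann_integrable f a b, Rabs (RiemannInt pr - l) < eps.

Definition int_0_inf (f : R -> R) : R :=
  epsilon (inhabits 0) (improper_int_0_inf f).

Definition gm_integrand (n : nat) (lam : R) (A B : Mat) (t : R) : Mat :=
  mscalR (Rpower t (lam - 1)) (minv n (madd (minv n A) (mscalR t (minv n B)))).

Definition mgmean_w (n : nat) (lam : R) (A B : Mat) : Mat :=
  fun i j =>
    CscalR (sin (lam * PI) / PI)
      (int_0_inf (fun t => Cre (gm_integrand n lam A B t i j)),
       int_0_inf (fun t => Cim (gm_integrand n lam A B t i j))).

Definition mgmean (n : nat) (A B : Mat) : Mat := mgmean_w n (1/2) A B.

(* Main.v *)
(** The two means agree: [A # B = (A nabla B) # (A ! B)] for all accretive [A] and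
    [B], so that both inequalities reduce to [cos alpha <= 1] and [0 <= Re (A # B)].

    Write [f0 t = (A^-1 + t B^-1)^-1] and [f1 t = (t A^-1 + B^-1)^-1], so that
    [f0 t = f1 (1 / t) / t].  The substitution [t = x^2], with [x] replaced by
    [1 / x] on [x > 1], gives
      [int_0^oo t^(-1/2) f0 t dt = int_0^1 2 (f0 (x^2) + f1 (x^2)) dx].
    For [A nabla B] and [A ! B] the integrand is
    [t^(-1/2) (f0 s + f1 s) / (v (v + 1))] with [v = sqrt (1 + t)] and
    [s = (v - 1) / (v + 1)], a partial fraction identity, and substituting
    [s = x^2] yields the same integral over [[0, 1]].  Positivity of the real part
    is inherited from [f0] and [f1]. *)

From mathcomp Require Import all_boot all_order all_algebra.
From mathcomp Require Import reals Rstruct complex.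
From mathcomp Require ring.
From Stdlib Require Import Reals Lra ClassicalEpsilon.
From Coquelicot Require Import Coquelicot.
Require Import Defs.
Open Scope R_scope.

(** * Improper integrals with the weight t^(-1/2) *)

(** Both limits are tested on one interval [[a, b]] that is admissible for each of them. *)
Lemma improper_int_unique (f : R -> R) (l l' : R) :
  improper_int_0_inf f l -> improper_int_0_inf f l' -> l = l'.
Proof.
intros H H'.
apply cond_eq; intros eps Heps.
destruct (H (eps / 2)) as (d & M & Hd & HM & K); try lra.
destruct (H' (eps / 2)) as (d' & M' & Hd' & HM' & K'); try lra.
set (a := Rmin d d' / 2); set (b := Rmax M M' + 1).
assert (Ha : 0 < a /\ a < d /\ a < d').
{ unfold a, Rmin; destruct (Rle_dec d d'); lra. }
assert (Hb : M < b /\ M' < b).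
{ unfold b, Rmax; destruct (Rle_dec M M'); lra. }
destruct (K a b) as (pr & P); try tauto.
destruct (K' a b) as (pr' & P'); try tauto.
(* The integral does not depend on the proof of integrability. *)
rewrite (RiemannInt_P5 pr' pr) in P'.
revert P P'; unfold Rabs; repeat destruct Rcase_abs; lra.
Qed.

Lemma int_0_inf_eq (f : R -> R) (l : R) :
  improper_int_0_inf f l -> int_0_inf f = l.
Proof.
intros H; apply improper_int_unique with (2 := H).
unfold int_0_inf; apply epsilon_spec; now exists l.
Qed.

(** The fundamental theorem of calculus on [[a, b]]; each end then contributes an error below
    [eps / 2]. *)
Lemma improper_int_of_antiderivative (F f : R -> R) (l0 l1 : R) :
  (forall t, 0 < t -> is_derive F t (f t)) ->
  (forall t, 0 < t -> continuous f t) ->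
  filterlim F (at_right 0) (locally l0) ->
  filterlim F (Rbar_locally p_infty) (locally l1) ->
  improper_int_0_inf f (l1 - l0).
Proof.
intros HD HC H0 H1 eps Heps.
assert (He : 0 < eps / 2) by lra.
destruct (H0 (ball l0 (mkposreal _ He)) (locally_ball _ _)) as [d Hd].
destruct (H1 (ball l1 (mkposreal _ He)) (locally_ball _ _)) as [M HM].
exists (Rmin d 1), (Rmax M 1).
pose proof (cond_pos d).
pose proof (Rmin_l d 1); pose proof (Rmin_r d 1).
pose proof (Rmax_l M 1); pose proof (Rmax_r M 1).
split; [apply Rmin_pos; lra|split; [lra|]].
intros a b Ha Had Hb.
assert (Hab : a <= b) by lra.
assert (I : is_RInt f a b (minus (F b) (F a))).
{ apply (@is_RInt_derive R_CompleteNormedModule); rewrite -> Rmin_left, Rmax_right by lra;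
    intros x Hx; [apply HD | apply HC]; lra. }
assert (E : ex_RInt f a b) by (eexists; exact I).
exists (ex_RInt_Reals_0 _ _ _ E).
rewrite <- RInt_Reals, (is_RInt_unique _ _ _ _ I).
assert (Pa : Rabs (F a - l0) < eps / 2).
{ apply (Hd a); [|exact Ha].
  unfold ball; simpl; unfold AbsRing_ball, abs, minus, plus, opp; simpl.
  rewrite Rabs_pos_eq; lra. }
assert (Pb : Rabs (F b - l1) < eps / 2) by (apply (HM b); lra).
unfold minus, plus, opp; simpl.
revert Pa Pb; unfold Rabs; repeat destruct Rcase_abs; lra.
Qed.

(* The substitution [t = x ^ 2] absorbs the weight of [t^(-1/2) f t dt]. *)
Definition sq_prim (f : R -> R) (r : R) : R := RInt (fun x => 2 * f (x ^ 2)) 0 r.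

Section Quadrature.

Variables f g : R -> R.
(** Composing with the square encodes continuity on the half-line [t >= 0], end point included; for
    negative arguments the resolvents may fail to exist. *)
Hypothesis cf : forall x, continuous (fun x => f (x ^ 2)) x.
Hypothesis cg : forall x, continuous (fun x => g (x ^ 2)) x.

Lemma continuous_scaled_sq (h : R -> R) :
  (forall x, continuous (fun x => h (x ^ 2)) x) ->
  forall x, continuous (fun x => 2 * h (x ^ 2)) x.
Proof.
intros ch x; apply (continuous_scal_r 2 (fun x => h (x ^ 2))), ch.
Qed.

Lemma is_derive_sq_prim (h : R -> R) :
  (forall x, continuous (fun x => h (x ^ 2)) x) ->
  forall r, is_derive (sq_prim h) r (2 * h (r ^ 2)).
Proof.
intros ch r; apply is_derive_RInt with (f := fun x => 2 * h (x ^ 2)) (a := 0).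
- exists (mkposreal 1 Rlt_0_1); intros y _.
  apply (@RInt_correct R_CompleteNormedModule).
  apply (@ex_RInt_continuous R_CompleteNormedModule).
  intros z _; now apply continuous_scaled_sq.
- now apply continuous_scaled_sq.
Qed.

Lemma continuous_sq_prim (h : R -> R) :
  (forall x, continuous (fun x => h (x ^ 2)) x) ->
  forall r, continuous (sq_prim h) r.
Proof.
intros ch r.
apply (@ex_derive_continuous R_AbsRing R_NormedModule).
eexists; now apply is_derive_sq_prim.
Qed.

Lemma sq_prim_0 (h : R -> R) : sq_prim h 0 = 0.
Proof. apply (@RInt_point R_CompleteNormedModule). Qed.

Lemma continuous_sqrt_comp_sq (h : R -> R) (t : R) :
  (forall x, continuous (fun x => h (x ^ 2)) x) -> 0 < t -> continuous h t.
Proof.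
intros ch Ht.
apply continuous_ext_loc with (fun t => h (sqrt t ^ 2)).
- exists (mkposreal t Ht); intros y Hy.
  rewrite pow2_sqrt; [reflexivity|].
  revert Hy; unfold ball; simpl; unfold AbsRing_ball, abs, minus, plus, opp; simpl.
  unfold Rabs; destruct Rcase_abs; lra.
- apply (continuous_comp sqrt (fun x => h (x ^ 2))); [|apply ch].
  apply continuous_sqrt.
Qed.

Lemma filterlim_at_right_continuous (h : R -> R) (a l : R) :
  continuous h a -> h a = l -> filterlim h (at_right a) (locally l).
Proof.
intros ch <- P HP; destruct (ch P HP) as [d Hd].
exists d; intros y Hy _; now apply Hd.
Qed.

Lemma filterlim_sqrt_0 : filterlim sqrt (at_right 0) (locally 0).
Proof.
apply filterlim_at_right_continuous; [apply continuous_sqrt | apply sqrt_0].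
Qed.

Lemma filterlim_inv_sqrt_infty :
  filterlim (fun t => / sqrt t) (Rbar_locally p_infty) (locally 0).
Proof.
intros P [d Hd]; exists (/ d ^ 2).
intros t Ht; apply Hd.
pose proof (cond_pos d).
assert (H1 : 0 < / d ^ 2) by (apply Rinv_0_lt_compat; nra).
assert (H2 : 0 < sqrt t) by (apply sqrt_lt_R0; lra).
unfold ball; simpl; unfold AbsRing_ball, abs, minus, plus, opp; simpl.
replace (/ sqrt t + - 0) with (/ sqrt t) by ring.
rewrite Rabs_pos_eq; [|left; now apply Rinv_0_lt_compat].
rewrite <- (Rinv_inv d); apply Rinv_lt_contravar.
- apply Rmult_lt_0_compat; [apply Rinv_0_lt_compat|]; lra.
- apply Rsqr_incrst_0; [| left; now apply Rinv_0_lt_compat | lra].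
  rewrite -> Rsqr_sqrt by lra.
  unfold Rsqr; rewrite <- Rinv_mult; simpl in Ht; now rewrite Rmult_1_r in Ht.
Qed.

Hypothesis fg : forall t, 0 < t -> f t = g (/ t) / t.

(** The inversion [x -> 1 / x] as a constancy statement: by [fg] the derivative of
    [sq_prim f r + sq_prim g (/ r)] vanishes, so its value at [r] is its value at [1]. *)
Lemma sq_prim_inv (r : R) : 0 < r ->
  sq_prim f r = sq_prim f 1 + sq_prim g 1 - sq_prim g (/ r).
Proof.
intros Hr.
set (D := fun r => sq_prim f r + sq_prim g (/ r)).
enough (E : D r = D 1) by (unfold D in E; rewrite Rinv_1 in E; lra).
assert (HD : forall x, 0 < x -> is_derive D x 0).
{ intros x Hx.
  replace 0 with (plus (2 * f (x ^ 2)) (scal (- / x ^ 2) (2 * g ((/ x) ^ 2)))).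
  - apply (is_derive_plus (sq_prim f) (fun r => sq_prim g (/ r))).
    + now apply is_derive_sq_prim.
    + apply (is_derive_comp (sq_prim g) Rinv); [now apply is_derive_sq_prim|].
      auto_derive; [lra|field; lra].
  - rewrite -> fg by (apply pow_lt; lra).
    rewrite pow_inv.
    unfold plus, scal; simpl; unfold mult; simpl; field; lra. }
destruct (MVT_gen D 1 r (fun _ => 0)) as (c & _ & Ec).
- intros x [Hx _]; apply HD.
  revert Hx; unfold Rmin; destruct Rle_dec; lra.
- intros x [Hx _]; apply continuity_pt_filterlim.
  apply (@ex_derive_continuous R_AbsRing R_NormedModule); exists 0; apply HD.
  revert Hx; unfold Rmin; destruct Rle_dec; lra.
- lra.
Qed.

(** [sq_prim f (sqrt t)] is an antiderivative of [h]; [sq_prim_inv] turns its limit at infinity into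
    the limit of [sq_prim g] at [0]. *)
Lemma improper_int_inv_sqrt (h : R -> R) :
  (forall t, 0 < t -> h t = / sqrt t * f t) ->
  improper_int_0_inf h (sq_prim f 1 + sq_prim g 1).
Proof.
intros Hh.
replace (sq_prim f 1 + sq_prim g 1) with
  ((sq_prim f 1 + sq_prim g 1) - sq_prim g 0 - sq_prim f 0)
  by (rewrite !sq_prim_0; ring).
apply improper_int_of_antiderivative with (F := fun t => sq_prim f (sqrt t)).
- intros t Ht.
  assert (Hs : 0 < sqrt t) by (now apply sqrt_lt_R0).
  replace (h t) with (scal (/ (2 * sqrt t)) (2 * f (sqrt t ^ 2))).
  + apply (is_derive_comp (sq_prim f) sqrt); [now apply is_derive_sq_prim|].
    auto_derive; [lra|field; lra].
  + rewrite -> pow2_sqrt, Hh by lra.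
    unfold scal; simpl; unfold mult; simpl; field; lra.
- intros t Ht.
  apply continuous_ext_loc with (fun t => / sqrt t * f t).
  + exists (mkposreal t Ht); intros y Hy; symmetry; apply Hh.
    revert Hy; unfold ball; simpl; unfold AbsRing_ball, abs, minus, plus, opp; simpl.
    unfold Rabs; destruct Rcase_abs; lra.
  + apply (continuous_mult (fun t => / sqrt t) f);
      [|now apply continuous_sqrt_comp_sq].
    apply continuous_Rinv_comp; [apply continuous_sqrt|].
    apply Rgt_not_eq; now apply sqrt_lt_R0.
- apply filterlim_comp with (1 := filterlim_sqrt_0); now apply continuous_sq_prim.
- apply filterlim_ext_loc with
    (fun t => (sq_prim f 1 + sq_prim g 1) - sq_prim g (/ sqrt t)).
  + exists 0; intros t Ht; symmetry; apply sq_prim_inv; now apply sqrt_lt_R0.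
  + apply (filterlim_comp_2 (G := locally (sq_prim f 1 + sq_prim g 1))
      (H := locally (- sq_prim g 0))
      (fun _ => sq_prim f 1 + sq_prim g 1) (fun t => - sq_prim g (/ sqrt t)) Rplus).
    * apply filterlim_const.
    * apply filterlim_comp with (locally (sq_prim g 0)).
      -- apply filterlim_comp with (1 := filterlim_inv_sqrt_infty);
         now apply continuous_sq_prim.
      -- apply (filterlim_opp (sq_prim g 0)).
    * apply (filterlim_plus (sq_prim f 1 + sq_prim g 1) (- sq_prim g 0)).
Qed.

(* With [t = 4 s / (1 - s)^2], i.e. [sqrt t = 2 r / (1 - r^2)] for [s = r^2]
   (the double-angle formula), [sqrt (1 + t) = (1 + s) / (1 - s)]. *)
Lemma improper_int_double_angle (h : R -> R) :
  (forall t, 0 < t ->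
     let v := sqrt (1 + t) in let s := (v - 1) / (v + 1) in
     h t = / sqrt t * (/ (v * (v + 1)) * (f s + g s))) ->
  improper_int_0_inf h (sq_prim f 1 + sq_prim g 1).
Proof.
intros Hh.
(* If [sqrt t = tan theta], then [rho t = tan (theta / 2)]; this is the [r] of the substitution,
   with [rho t ^ 2 = s]. *)
set (rho := fun t => sqrt t / (1 + sqrt (1 + t))).
set (F := fun r => sq_prim f r + sq_prim g r).
assert (Fd : forall r, is_derive F r (2 * f (r ^ 2) + 2 * g (r ^ 2))).
{ intros r; apply (is_derive_plus (sq_prim f) (sq_prim g));
    now apply is_derive_sq_prim. }
assert (Fc : forall r, continuous F r).
{ intros r; apply (@ex_derive_continuous R_AbsRing R_NormedModule).
  eexists; apply Fd. }
assert (pos : forall t, 0 < t ->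
  0 < sqrt t /\ 0 < sqrt (1 + t) /\ sqrt (1 + t) * sqrt (1 + t) = 1 + t
  /\ sqrt t * sqrt t = t).
{ intros t Ht; repeat split; try apply sqrt_lt_R0; try apply sqrt_sqrt; lra. }
assert (rho2 : forall t, 0 < t ->
  (sqrt (1 + t) - 1) / (sqrt (1 + t) + 1) = rho t ^ 2).
{ intros t Ht; destruct (pos t Ht) as (P1 & P2 & P3 & P4).
  unfold rho; set (v := sqrt (1 + t)) in *.
  replace ((sqrt t / (1 + v)) ^ 2) with (sqrt t * sqrt t / (1 + v) ^ 2)
    by (field; lra).
  replace (sqrt t * sqrt t) with (v * v - 1) by lra; field; lra. }
(* The derivative of [rho], simplified by [t = v ^ 2 - 1]; its factor [1 / (v (v + 1))] is the one
   in the hypothesis on [h]. *)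
set (drho := fun t => / (2 * sqrt t * (sqrt (1 + t) * (1 + sqrt (1 + t))))).
assert (rhod : forall t, 0 < t -> is_derive rho t (drho t)).
{ intros t Ht; destruct (pos t Ht) as (P1 & P2 & P3 & P4).
  unfold rho, drho; auto_derive; [repeat split; lra|].
  set (v := sqrt (1 + t)) in *.
  transitivity ((v * (1 + v) - sqrt t * sqrt t) / (2 * sqrt t * v * (1 + v) ^ 2));
    [field; repeat split; lra|].
  replace (sqrt t * sqrt t) with (v * v - 1) by lra; field; repeat split; lra. }
assert (hE : forall t, 0 < t ->
  scal (drho t) (2 * f (rho t ^ 2) + 2 * g (rho t ^ 2)) = h t).
{ intros t Ht; destruct (pos t Ht) as (P1 & P2 & _).
  rewrite -> Hh, rho2 by easy.
  unfold drho, scal; simpl; unfold mult; simpl; field; repeat split; lra. }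
replace (sq_prim f 1 + sq_prim g 1) with (F 1 - F 0)
  by (unfold F; rewrite !sq_prim_0; ring).
apply improper_int_of_antiderivative with (F := fun t => F (rho t)).
- intros t Ht; rewrite <- hE by easy.
  apply (is_derive_comp F rho); [apply Fd | now apply rhod].
- intros t Ht.
  apply continuous_ext_loc with
    (fun t => drho t * (2 * f (rho t ^ 2) + 2 * g (rho t ^ 2))).
  + exists (mkposreal t Ht); intros y Hy; apply hE.
    revert Hy; unfold ball; simpl; unfold AbsRing_ball, abs, minus, plus, opp; simpl.
    unfold Rabs; destruct Rcase_abs; lra.
  + destruct (pos t Ht) as (P1 & P2 & _).
    apply (continuous_mult drho (fun t => 2 * f (rho t ^ 2) + 2 * g (rho t ^ 2))).
    * apply (@ex_derive_continuous R_AbsRing R_NormedModule).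
      unfold drho; auto_derive; repeat split; try lra.
      apply Rgt_not_eq; repeat apply Rmult_lt_0_compat; lra.
    * apply (continuous_comp rho (fun r => 2 * f (r ^ 2) + 2 * g (r ^ 2))).
      -- apply (@ex_derive_continuous R_AbsRing R_NormedModule).
         eexists; now apply rhod.
      -- apply (continuous_plus (fun r => 2 * f (r ^ 2)) (fun r => 2 * g (r ^ 2)));
           now apply continuous_scaled_sq.
- apply filterlim_comp with (2 := Fc 0).
  apply filterlim_at_right_continuous;
    [|unfold rho; rewrite sqrt_0; unfold Rdiv; ring].
  + assert (0 < 1 + sqrt (1 + 0)) by (pose proof (sqrt_pos (1 + 0)); lra).
    apply (continuous_mult sqrt (fun t => / (1 + sqrt (1 + t)))).
    * apply continuous_sqrt.
    * apply continuous_Rinv_comp; [|lra].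
      apply (continuous_plus (fun _ => 1) (fun t => sqrt (1 + t)));
        [apply continuous_const|].
      apply (continuous_comp (fun t => 1 + t) sqrt); [|apply continuous_sqrt].
      apply (continuous_plus (fun _ => 1) (fun t => t));
        [apply continuous_const|apply continuous_id].
- apply filterlim_comp with (2 := Fc 1).
  (* Squeeze: [1 - rho t = (1 + v - sqrt t) / (1 + v)], where [0 <= v - sqrt t <= 1] and
     [1 + v >= sqrt t]. *)
  apply (filterlim_le_le (fun t => 1 - 2 * / sqrt t) rho (fun _ => 1) 1).
  + exists 0; intros t Ht; destruct (pos t Ht) as (P1 & P2 & P3 & P4).
    unfold rho; split.
    * apply Rmult_le_reg_r with (sqrt t * (1 + sqrt (1 + t))); [nra|].
      field_simplify; try lra. nra.
    * apply Rmult_le_reg_r with (1 + sqrt (1 + t)); [lra|].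
      field_simplify; try lra. nra.
  + apply filterlim_comp with (f := fun t => / sqrt t) (g := fun x => 1 - 2 * x)
      (1 := filterlim_inv_sqrt_infty).
    assert (cl : continuous (fun x => 1 - 2 * x) 0).
    { apply (@ex_derive_continuous R_AbsRing R_NormedModule); auto_derive; easy. }
    unfold continuous in cl; replace (1 - 2 * 0) with 1 in cl by ring; exact cl.
  + apply filterlim_const.
Qed.

End Quadrature.

Section AccretiveMeans.

Import mathcomp.algebra_tactics.ring.
Import Order.TTheory GRing.Theory Num.Theory.
Set Implicit Arguments. Unset Strict Implicit. Unset Printing Implicit Defensive.
Local Open Scope ring_scope.
Local Notation RC := (complex.complex R).

(** * Resolvents of a pair of accretive matrices *)

Lemma invmx_eq (F : fieldType) n (X Y : 'M[F]_n) : X *m Y = 1%:M -> invmx X = Y.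
Proof.
move=> XY; have [uX _] := mulmx1_unit XY.
by rewrite -[Y]mul1mx -(mulVmx uX) -mulmxA XY mulmx1.
Qed.

Section Scalars.
Variables (F : fieldType) (v : F).
Hypothesis n2 : 2 != 0 :> F.

Let four_neq0 : 4 != 0 :> F.
Proof. by rewrite (_ : 4 = 2 * 2) ?mulf_neq0 // -natrM. Qed.

(** Entrywise expansion of [(A + B)(A^-1 + B^-1) / 4]: [d], [a], [q] stand for entries of [1],
    [B A^-1], [A B^-1]. *)
Lemma means_prefactor (d a q : F) :
  d + (v ^+ 2 - 1) * (2^-1 * (2^-1 * (d + a + (q + d)))) =
  d + (v ^+ 2 - 1) / 4 * (2 * d + a + q).
Proof.
by field; rewrite n2 four_neq0.
Qed.

(** The four linear relations eliminate the [u]'s. The coefficient of [x + y] is then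
    [1 - (v^2 - 1)(1 - s)^2 / (4 s) = 0], since [1 - s = 2 / (v + 1)], and that of [a + b] is
    [(v^2 - 1)(1 + 1 / s) / 4 = v (v + 1) / 2]. *)
Lemma means_resolvent_entry (s a b x y u1 u2 u3 u4 : F) :
  v != 0 -> v + 1 != 0 -> v - 1 != 0 -> s = (v - 1) / (v + 1) ->
  a = x + s * u1 -> b = u2 + s * x -> a = s * y + u3 -> b = s * u4 + y ->
  (v * (v + 1))^-1 * (x + y + (v ^+ 2 - 1) / 4 *
      (2 * (x + y) + (u2 + u4) + (u1 + u3))) = 2^-1 * (a + b).
Proof.
move=> v0 v1 v1' sE Ha Hb Ha' Hb'.
have s0 : s != 0 by rewrite sE mulf_neq0 ?invr_neq0.
have -> : u1 = (a - x) / s by rewrite Ha; field.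
have -> : u2 = b - s * x by rewrite Hb; ring.
have -> : u3 = a - s * y by rewrite Ha'; ring.
have -> : u4 = (b - y) / s by rewrite Hb'; field.
by rewrite sE; field; rewrite v0 v1 v1' n2 four_neq0.
Qed.
End Scalars.

Section Pencil.
Variables (F : fieldType) (n : nat) (A B : 'M[F]_n).
Hypotheses (uA : A \in unitmx) (uB : B \in unitmx).

(** Two weights, so that [f0 t] and [f1 t] are the inverses of [pencil 1 t] and [pencil t 1]. *)
Definition pencil (p q : F) : 'M[F]_n := p *: invmx A + q *: invmx B.

(** Reduces invertibility of the pencil to that of a combination of [A] and [B] themselves. *)
Lemma pencilE p q : pencil p q = invmx A *m (p *: B + q *: A) *m invmx B.
Proof.
by rewrite mulmxDr mulmxDl -!scalemxAr -!scalemxAl mulmxK // mulVmx // mul1mx.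
Qed.

Lemma unitmx_pencil p q :
  (pencil p q \in unitmx) = (p *: B + q *: A \in unitmx).
Proof. by rewrite pencilE !unitmx_mul !unitmx_inv uA uB andbT. Qed.

Lemma invmx_pencil_recip t : t != 0 -> pencil t^-1 1 \in unitmx ->
  invmx (pencil 1 t) = t^-1 *: invmx (pencil t^-1 1).
Proof.
move=> t0 u; have -> : pencil 1 t = t *: pencil t^-1 1.
  by rewrite /pencil scalerDr !scalerA mulfV // mulr1.
apply: invmx_eq.
by rewrite -scalemxAl -scalemxAr scalerA mulfV // scale1r mulmxV.
Qed.

(* Up to the left factor [A], both sides are rational functions of
   [invmx B *m A]; the right one is the partial fraction decomposition of the
   left one, whose poles are [- s] and [- s^-1]. *)
Lemma invmx_pencil_means (v : F) (s := (v - 1) / (v + 1)) :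
  2 != 0 :> F -> v != 0 -> v + 1 != 0 -> v - 1 != 0 ->
  A + B \in unitmx -> pencil 1 s \in unitmx -> pencil s 1 \in unitmx ->
  invmx (invmx (2^-1 *: (A + B)) +
         (v ^+ 2 - 1) *: (2^-1 *: (invmx A + invmx B))) =
  (v * (v + 1))^-1 *: (invmx (pencil 1 s) + invmx (pencil s 1)).
Proof.
move=> n2 v0 v1 v1' uAB u1 u2.
have uC : 2^-1 *: (A + B) \in unitmx.
  by rewrite unitmxZ // unitfE invr_neq0.
set S := invmx (pencil 1 s); set T := invmx (pencil s 1).
(* Multiplying on the left by [(A + B) / 2] removes the inverse of [A + B]. *)
apply: invmx_eq; apply: (can_inj (mulKmx uC)); rewrite mulmx1 mulmxA.
have -> : 2^-1 *: (A + B) *m (invmx (2^-1 *: (A + B)) +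
    (v ^+ 2 - 1) *: (2^-1 *: (invmx A + invmx B))) =
    1%:M + ((v ^+ 2 - 1) / 4) *: (2 *: 1%:M + B *m invmx A + A *m invmx B).
  rewrite mulmxDr mulmxV // -!scalemxAr -scalemxAl mulmxDr !mulmxDl !mulmxV //.
  by apply/matrixP => i j; rewrite !mxE; exact: means_prefactor.
rewrite -scalemxAr mulmxDl mul1mx -scalemxAl !mulmxDl -scalemxAl mul1mx !mulmxDr.
have ES : pencil 1 s *m S = 1%:M by exact: mulmxV.
have ET : pencil s 1 *m T = 1%:M by exact: mulmxV.
(* Multiplying [pencil 1 s *m S = 1] and [pencil s 1 *m T = 1] by [A] and by [B] gives four linear
   relations, which are all that the entrywise computation uses about [S] and [T]. *)
have : A *m (pencil 1 s *m S) = S + s *: (A *m invmx B *m S).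
  by rewrite mulmxDl -!scalemxAl scale1r mulmxDr mulKVmx // -scalemxAr mulmxA.
have : B *m (pencil 1 s *m S) = B *m invmx A *m S + s *: S.
  by rewrite mulmxDl -!scalemxAl scale1r mulmxDr -scalemxAr mulKVmx // mulmxA.
have : A *m (pencil s 1 *m T) = s *: T + A *m invmx B *m T.
  by rewrite mulmxDl -!scalemxAl scale1r mulmxDr -scalemxAr mulKVmx // mulmxA.
have : B *m (pencil s 1 *m T) = s *: (B *m invmx A *m T) + T.
  by rewrite mulmxDl -!scalemxAl scale1r mulmxDr -scalemxAr mulKVmx // mulmxA.
rewrite ES ET !mulmx1.
move: (B *m invmx A *m T) (A *m invmx B *m T) (B *m invmx A *m S)
  (A *m invmx B *m S) => U4 U3 U2 U1 /matrixP H4 /matrixP H3 /matrixP H2 /matrixP H1.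
apply/matrixP => i j; move: {H1 H2 H3 H4}(H1 i j) (H2 i j) (H3 i j) (H4 i j).
rewrite !mxE.
exact: means_resolvent_entry.
Qed.
End Pencil.

(** * Accretive complex matrices through the real inner product *)

Definition rC (r : R) : RC := complex.Complex r 0.

Arguments rC r%_ring_scope.

Lemma rC_neq0 (r : R) : r != 0 -> rC r != 0.
Proof. by apply: contra => /eqP [->]. Qed.

Lemma rC1 : rC 1 = 1.
Proof. by []. Qed.

Lemma rCD (r s : R) : rC (r + s) = rC r + rC s.
Proof. by apply/eqP; rewrite eq_complex /= addr0 !eqxx. Qed.

Lemma rCM (r s : R) : rC (r * s) = rC r * rC s.
Proof. by apply/eqP; rewrite eq_complex /= !mulr0 !mul0r subr0 addr0 !eqxx. Qed.

Lemma rCV (r : R) : r != 0 -> rC r^-1 = (rC r)^-1.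
Proof.
move=> r0; apply: (mulfI (rC_neq0 r0)).
by rewrite -rCM (mulfV r0) (mulfV (rC_neq0 r0)).
Qed.

Section RealInner.
Variable n : nat.
Implicit Types (u v w : 'cV[RC]_n) (A B : 'M[RC]_n).

(** The real part of the Hermitian product, that is, the Euclidean product of [R^(2n)]. *)
Definition rdot u v : R :=
  \sum_i (complex.Re (u i 0) * complex.Re (v i 0) +
          complex.Im (u i 0) * complex.Im (v i 0)).

Lemma rdotC u v : rdot u v = rdot v u.
Proof.
apply: eq_bigr => i _.
by rewrite ![_ * complex.Re (u _ _)]mulrC ![_ * complex.Im (u _ _)]mulrC.
Qed.

Lemma rdotDl u v w : rdot (u + v) w = rdot u w + rdot v w.
Proof.
rewrite -big_split; apply: eq_bigr => i _ /=; rewrite !mxE.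
case: (u i 0) (v i 0) => [a b] [c d] /=; by rewrite !mulrDl addrACA.
Qed.

Lemma rdotZl r u v : rdot (rC r *: u) v = r * rdot u v.
Proof.
rewrite mulr_sumr; apply: eq_bigr => i _ /=; rewrite !mxE.
by case: (u i 0) => [a b] /=; rewrite !mul0r subr0 addr0 mulrDr !mulrA.
Qed.

Lemma rdot0l v : rdot 0 v = 0.
Proof. by apply: big1 => i _; rewrite mxE /= !mul0r addr0. Qed.

Definition accretive_mx A := forall v, v != 0 -> 0 < rdot (A *m v) v.

Lemma accretive_mx_ge0 A v : accretive_mx A -> 0 <= rdot (A *m v) v.
Proof.
move=> hA; have [->|v0] := eqVneq v 0; first by rewrite mulmx0 rdot0l.
exact/ltW/hA.
Qed.

(** A kernel vector [v] would give [rdot (A *m v) v = 0]. The transposes appear because [row_free]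
    acts on row vectors. *)
Lemma accretive_mx_unit A : accretive_mx A -> A \in unitmx.
Proof.
move=> hA; rewrite -unitmx_tr -row_free_unit; apply: inj_row_free => v vA.
apply: trmx_inj; apply/eqP; rewrite trmx0; apply: contraT => v0.
have := hA _ v0.
by rewrite -[A]trmxK -trmx_mul vA trmx0 rdot0l ltxx.
Qed.

Lemma accretive_mx_comb A B p q : accretive_mx A -> accretive_mx B ->
  0 <= p -> 0 <= q -> 0 < p + q -> accretive_mx (rC p *: A + rC q *: B).
Proof.
move=> hA hB p0 q0 pq v v0; rewrite mulmxDl -!scalemxAl rdotDl !rdotZl.
have HA := hA _ v0; have HB := hB _ v0.
move: p0; rewrite le_eqVlt => /orP[/eqP p0|p0].
  by move: pq; rewrite -p0 add0r mul0r add0r => q0'; exact: mulr_gt0.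
by apply: ltr_wpDr; [apply: mulr_ge0 => //; exact: ltW | exact: mulr_gt0].
Qed.

(** With [v = A w], the form of the inverse at [v] is [rdot w (A w)], and [rdot] is symmetric. *)
Lemma accretive_mx_inv A : accretive_mx A -> accretive_mx (invmx A).
Proof.
move=> hA v v0; have uA := accretive_mx_unit hA.
rewrite rdotC -{1}(mulKVmx uA v); apply: hA.
by apply: contraNneq v0 => Av0; rewrite -(mulKVmx uA v) Av0 mulmx0.
Qed.

Section Resolvent.
Variables A B : 'M[RC]_n.
Hypotheses (hA : accretive_mx A) (hB : accretive_mx B).

Let uA := accretive_mx_unit hA.
Let uB := accretive_mx_unit hB.

Lemma unitmx_rpencil p q : 0 <= p -> 0 <= q -> 0 < p + q ->
  pencil A B (rC p) (rC q) \in unitmx.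
Proof.
move=> p0 q0 pq; rewrite unitmx_pencil //.
exact/accretive_mx_unit/accretive_mx_comb.
Qed.

(** The same change of vector, used twice: first for the pencil, then for [A] and [B] inside it. *)
Lemma rdot_invmx_pencil_ge0 p q x : 0 <= p -> 0 <= q -> 0 < p + q ->
  0 <= rdot (invmx (pencil A B (rC p) (rC q)) *m x) x.
Proof.
move=> p0 q0 pq; have u := unitmx_rpencil p0 q0 pq.
set y := _ *m x; have -> : x = pencil A B (rC p) (rC q) *m y by rewrite mulKVmx.
clearbody y; rewrite rdotC mulmxDl -!scalemxAl rdotDl !rdotZl.
rewrite addr_ge0 // mulr_ge0 //.
  by rewrite rdotC -{1}(mulKVmx uA y) accretive_mx_ge0.
by rewrite rdotC -{1}(mulKVmx uB y) accretive_mx_ge0.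
Qed.

(** For [v > 1] one has [s > 0], so accretivity supplies every invertibility condition of
    [invmx_pencil_means]. *)
Lemma invmx_rpencil_means (v : R) (s := (v - 1) / (v + 1)) : 1 < v ->
  invmx (invmx (rC 2^-1 *: (A + B)) +
         rC (v ^+ 2 - 1) *: (rC 2^-1 *: (invmx A + invmx B))) =
  rC (v * (v + 1))^-1 *: (invmx (pencil A B 1 (rC s)) + invmx (pencil A B (rC s) 1)).
Proof.
move=> v1; have v0 : 0 < v by apply: lt_trans v1.
have v1' : 0 < v - 1 by rewrite subr_gt0.
have v2 : 0 < v + 1 by rewrite addr_gt0.
have s0 : 0 < s by rewrite divr_gt0.
have n2 : (2%:R : R) != 0 by rewrite pnatr_eq0.
have E2 : rC 2%:R = 2 by exact: (rCD 1 1).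
have rC2 : rC 2^-1 = 2^-1 by rewrite (rCV n2) E2.
have rCs : rC s = (rC v - 1) / (rC v + 1).
  by rewrite /s rCM rCV ?gt_eqF // !rCD rC1 /rC /GRing.opp /= oppr0.
rewrite rC2 rCV ?gt_eqF ?mulr_gt0 // rCM rCD rC1.
rewrite (_ : rC (v ^+ 2 - 1) = rC v ^+ 2 - 1); last first.
  by rewrite rCD expr2 rCM /rC /GRing.opp /= oppr0.
rewrite rCs; have vn0 : v != 0 by rewrite gt_eqF.
apply: invmx_pencil_means; rewrite ?rC_neq0 //.
- by rewrite -E2 rC_neq0.
- by rewrite -rC1 -rCD rC_neq0 // gt_eqF.
- by rewrite (_ : rC v - 1 = rC (v - 1)) ?rC_neq0 ?gt_eqF // rCD /rC /GRing.opp /= oppr0.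
- have := @accretive_mx_comb A B 1 1 hA hB ler01 ler01 (addr_gt0 ltr01 ltr01).
  by rewrite rC1 !scale1r => /accretive_mx_unit.
- by rewrite -rCs -rC1 unitmx_rpencil // ?ltW // addr_gt0.
- by rewrite -rCs -rC1 unitmx_rpencil // ?ltW // addr_gt0.
Qed.

End Resolvent.
End RealInner.

(** * Matrices as functions and MathComp matrices *)

Definition toC (z : Defs.C) : RC := complex.Complex z.1 z.2.

(** General in [phi] so as to cover both [toC] and [Cre]. *)
Lemma Csum_morph (V : nmodType) (phi : Defs.C -> V) (n : nat) (f : nat -> Defs.C) :
  phi C0 = 0 -> (forall x y, phi (Cadd x y) = phi x + phi y) ->
  phi (Csum n f) = \sum_(i < n) phi (f i).
Proof.
move=> phi0 phiD; rewrite -(big_mkord xpredT (phi \o f)) /index_iota subn0.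
rewrite /Csum -[List.seq _ _]/(seq.iota 0 n).
elim: (seq.iota 0 n) => [|i s IH] /=; first by rewrite big_nil.
by rewrite big_cons phiD IH.
Qed.

Lemma toC_sum n f : toC (Csum n f) = \sum_(i < n) toC (f i).
Proof. exact: Csum_morph. Qed.

Definition Rops_mcE := (RplusE, RminusE, RmultE, RoppE).

Lemma halfE : Rdiv 1 2 = (2%:R : R)^-1.
Proof.
apply: (@mulfI _ (2%:R : R)); first by rewrite pnatr_eq0.
rewrite mulfV ?pnatr_eq0 //.
change (Rmult (Rplus R1 R1) (Rdiv 1 2) = R1).
by Lra.lra.
Qed.

Section Bridge.
Variable n : nat.

Definition mx (A : Mat) : 'M[RC]_n := \matrix_(i, j) toC (A i j).
Definition cv (x : Vec) : 'cV[RC]_n := \col_i toC (x i).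

Lemma mx_eqP (A B : Mat) : meq n A B <-> mx A = mx B.
Proof.
split=> [AB | /matrixP AB i j /ssrnat.ltP hi /ssrnat.ltP hj].
  by apply/matrixP => i j; rewrite !mxE AB //; apply/ssrnat.ltP.
have := AB (Ordinal hi) (Ordinal hj); rewrite !mxE /= /toC.
by case: (A i j) (B i j) => [a b] [c d] /= [-> ->].
Qed.

Lemma mx_mul (A B : Mat) : mx (mmul n A B) = mx A *m mx B.
Proof.
apply/matrixP => i j; rewrite !mxE toC_sum; apply: eq_bigr => k _; by rewrite !mxE.
Qed.

Lemma mx_add (A B : Mat) : mx (madd A B) = mx A + mx B.
Proof. by apply/matrixP => i j; rewrite !mxE. Qed.

Lemma mx_scalR r (A : Mat) : mx (mscalR r A) = rC r *: mx A.
Proof.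
apply/matrixP => i j; rewrite !mxE; apply/eqP; rewrite eq_complex /=.
by rewrite !mul0r subr0 addr0 !eqxx.
Qed.

Lemma mx_id : mx mid = 1%:M.
Proof.
apply/matrixP => i j; rewrite !mxE /mid; case: Nat.eq_dec => [/val_inj-> | ij].
  by rewrite eqxx.
by case: eqP => // eij; case: ij; rewrite eij.
Qed.

(** Provides the witness that [epsilon_spec] requires in [mx_inv]; entries outside the range get the
    default [C0]. *)
Lemma mx_surj (M : 'M[RC]_n) : exists A, mx A = M.
Proof.
exists (fun i j => if insub i is Some i' then
  if insub j is Some j' then (complex.Re (M i' j'), complex.Im (M i' j')) else C0
  else C0).
by apply/matrixP => i j; rewrite !mxE !valK /toC /=; case: (M i j).
Qed.

Lemma cv_surj (v : 'cV[RC]_n) : exists x, cv x = v.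
Proof.
exists (fun i => if insub i is Some i' then
  (complex.Re (v i' 0), complex.Im (v i' 0)) else C0).
by apply/colP => i; rewrite !mxE !valK /toC /=; case: (v i 0).
Qed.

Lemma mx_inv (A : Mat) : mx A \in unitmx -> mx (minv n A) = invmx (mx A).
Proof.
move=> uA; have [X XE] := mx_surj (invmx (mx A)).
suff [/mx_eqP AX _] : is_inverse n A (minv n A).
  by apply/esym/invmx_eq; rewrite -mx_mul AX mx_id.
apply: epsilon_spec; exists X; split; apply/mx_eqP.
  by rewrite mx_mul XE mx_id mulmxV.
by rewrite mx_mul XE mx_id mulVmx.
Qed.

Lemma Cre_cinner (u v : Vec) : Cre (cinner n u v) = rdot (cv u) (cv v).
Proof.
rewrite /cinner (@Csum_morph R Cre) //; apply: eq_bigr => i _; rewrite !mxE /=.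
by rewrite /Cre /= !Rops_mcE mulrN opprK.
Qed.

Lemma cv_mvmul (A : Mat) (x : Vec) : cv (mvmul n A x) = mx A *m cv x.
Proof.
apply/colP => i; rewrite !mxE toC_sum; apply: eq_bigr => k _; by rewrite !mxE.
Qed.

(** Displays the form as a real-linear combination of the real and imaginary parts of the entries of
    [M], ready for transposition and for termwise integration. *)
Lemma rdot_mulmx (M : 'M[RC]_n) (v : 'cV[RC]_n) :
  rdot (M *m v) v = \sum_i \sum_j
   (complex.Re (M i j) * (complex.Re (v j 0) * complex.Re (v i 0) +
                          complex.Im (v j 0) * complex.Im (v i 0)) +
    complex.Im (M i j) * (complex.Re (v j 0) * complex.Im (v i 0) -
                          complex.Im (v j 0) * complex.Re (v i 0))).
Proof.
apply: eq_bigr => i _; rewrite !mxE !raddf_sum /= !mulr_suml -big_split /=.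
apply: eq_bigr => j _; case: (M i j) (v j 0) (v i 0) => [a b] [c d] [e f] /=.
ring.
Qed.

Lemma Cre_cinner_ReM (A : Mat) (x : Vec) :
  Cre (cinner n (mvmul n (Defs.ReM A) x) x) = Cre (cinner n (mvmul n A x) x).
Proof.
rewrite !Cre_cinner !cv_mvmul !rdot_mulmx.
set G := (X in _ = X).
transitivity (2^-1 * (G + G)); last by field.
(* Exchanging the two summation indices produces the contribution of the adjoint. *)
have GE : G = \sum_i \sum_j
   (complex.Re (mx A j i) * (complex.Re (cv x i 0) * complex.Re (cv x j 0) +
                             complex.Im (cv x i 0) * complex.Im (cv x j 0)) +
    complex.Im (mx A j i) * (complex.Re (cv x i 0) * complex.Im (cv x j 0) -
                             complex.Im (cv x i 0) * complex.Re (cv x j 0))).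
  by rewrite /G exchange_big.
rewrite {2}GE /G -big_split mulr_sumr; apply: eq_bigr => i _.
rewrite -big_split mulr_sumr; apply: eq_bigr => j _ /=; rewrite !mxE /= halfE !Rops_mcE.
by field.
Qed.

Lemma accretive_mxP (A : Mat) : accretive n A -> accretive_mx (mx A).
Proof.
case=> _ hA v v0; have [x xv] := cv_surj v.
have x0 : vnonzero n x.
  have [i vi0] : exists i, v i 0 != 0.
    apply/existsP; apply: contraR v0; rewrite negb_exists => /forallP v0.
    by apply/eqP/colP => i; rewrite mxE; apply/eqP; rewrite -[_ == _]negbK.
  exists i; split; first exact/ssrnat.ltP.
  by move=> xi0; move: vi0; rewrite -xv mxE xi0 eqxx.
apply/RltP; have := hA x x0; rewrite Cre_cinner_ReM Cre_cinner cv_mvmul xv.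
exact.
Qed.
End Bridge.

(** * Continuity of complex-valued functions and of matrix inversion *)

Section ComplexContinuity.

Definition ccont (F : R -> RC) (x : R) : Prop :=
  continuous (fun t => complex.Re (F t)) x /\ continuous (fun t => complex.Im (F t)) x.

Lemma ccont_ext F G x : (forall t, F t = G t) -> ccont F x -> ccont G x.
Proof.
by move=> FG [h1 h2]; split; [apply: continuous_ext h1 | apply: continuous_ext h2] => t;
  rewrite FG.
Qed.

Lemma ccont_const c x : ccont (fun _ => c) x.
Proof. by split; apply: continuous_const. Qed.

Lemma ccontD F G x : ccont F x -> ccont G x -> ccont (fun t => F t + G t) x.
Proof.
move=> [f1 f2] [g1 g2]; split.
  apply: (continuous_ext (fun t => complex.Re (F t) + complex.Re (G t))).
    by move=> t; case: (F t) (G t) => [? ?] [? ?].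
  exact: (continuous_plus (fun t => complex.Re (F t)) (fun t => complex.Re (G t))).
apply: (continuous_ext (fun t => complex.Im (F t) + complex.Im (G t))).
  by move=> t; case: (F t) (G t) => [? ?] [? ?].
exact: (continuous_plus (fun t => complex.Im (F t)) (fun t => complex.Im (G t))).
Qed.

Lemma ccontM F G x : ccont F x -> ccont G x -> ccont (fun t => F t * G t) x.
Proof.
move=> [f1 f2] [g1 g2]; split.
  apply: (continuous_ext (fun t => Rminus (Rmult (complex.Re (F t)) (complex.Re (G t)))
     (Rmult (complex.Im (F t)) (complex.Im (G t))))).
    by move=> t; case: (F t) (G t) => [? ?] [? ?].
  apply: (continuous_minus (fun t => Rmult (complex.Re (F t)) (complex.Re (G t)))
    (fun t => Rmult (complex.Im (F t)) (complex.Im (G t)))).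
    exact: (continuous_mult (fun t => complex.Re (F t)) (fun t => complex.Re (G t))).
  exact: (continuous_mult (fun t => complex.Im (F t)) (fun t => complex.Im (G t))).
apply: (continuous_ext (fun t => Rplus (Rmult (complex.Re (F t)) (complex.Im (G t)))
     (Rmult (complex.Im (F t)) (complex.Re (G t))))).
  by move=> t; case: (F t) (G t) => [? ?] [? ?].
apply: (continuous_plus (fun t => Rmult (complex.Re (F t)) (complex.Im (G t)))
    (fun t => Rmult (complex.Im (F t)) (complex.Re (G t)))).
  exact: (continuous_mult (fun t => complex.Re (F t)) (fun t => complex.Im (G t))).
exact: (continuous_mult (fun t => complex.Im (F t)) (fun t => complex.Re (G t))).
Qed.

Lemma ccontV F x : F x != 0 -> ccont F x -> ccont (fun t => (F t)^-1) x.
Proof.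
move=> Fx [f1 f2].
(* [N] is the squared modulus, and [1 / z] is the conjugate of [z] divided by it. *)
set N := fun t => Rplus (Rmult (complex.Re (F t)) (complex.Re (F t)))
                        (Rmult (complex.Im (F t)) (complex.Im (F t))).
have cN : continuous (fun t => Rinv (N t)) x.
  apply: continuous_Rinv_comp.
    apply: (continuous_plus (fun t => Rmult (complex.Re (F t)) (complex.Re (F t)))
      (fun t => Rmult (complex.Im (F t)) (complex.Im (F t)))).
      exact: (continuous_mult (fun t => complex.Re (F t)) (fun t => complex.Re (F t))).
    exact: (continuous_mult (fun t => complex.Im (F t)) (fun t => complex.Im (F t))).
  move/eqP; rewrite /N; apply/negP; move: Fx; case: (F x) => [a b] /=.
  apply: contra; rewrite !Rops_mcE -!expr2 (paddr_eq0 (sqr_ge0 a) (sqr_ge0 b)) !sqrf_eq0.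
  by move=> /andP[/eqP-> /eqP->].
split.
  apply: (continuous_ext (fun t => Rmult (complex.Re (F t)) (Rinv (N t)))).
    by move=> t; rewrite /N; case: (F t).
  exact: (continuous_mult (fun t => complex.Re (F t)) (fun t => Rinv (N t))).
apply: (continuous_ext (fun t => Ropp (Rmult (complex.Im (F t)) (Rinv (N t))))).
  by move=> t; rewrite /N; case: (F t).
apply: (continuous_opp (fun t => Rmult (complex.Im (F t)) (Rinv (N t)))).
exact: (continuous_mult (fun t => complex.Im (F t)) (fun t => Rinv (N t))).
Qed.

Lemma ccont_sum (I : Type) (s : seq I) (F : I -> R -> RC) x :
  (forall i, ccont (F i) x) -> ccont (fun t => \sum_(i <- s) F i t) x.
Proof.
move=> cF; elim: s => [|i s IH].
  by apply: (ccont_ext (F := fun _ => 0)) (ccont_const _ _) => t; rewrite big_nil.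
by apply: (ccont_ext (F := fun t => F i t + \sum_(i <- s) F i t)) (ccontD _ _) => // t;
  rewrite big_cons.
Qed.

Lemma ccont_prod (I : Type) (s : seq I) (F : I -> R -> RC) x :
  (forall i, ccont (F i) x) -> ccont (fun t => \prod_(i <- s) F i t) x.
Proof.
move=> cF; elim: s => [|i s IH].
  by apply: (ccont_ext (F := fun _ => 1)) (ccont_const _ _) => t; rewrite big_nil.
by apply: (ccont_ext (F := fun t => F i t * \prod_(i <- s) F i t)) (ccontM _ _) => // t;
  rewrite big_cons.
Qed.

Lemma ccont_det n (M : R -> 'M[RC]_n) x :
  (forall i j, ccont (fun t => M t i j) x) -> ccont (fun t => \det (M t)) x.
Proof.
move=> cM; apply: ccont_sum => s; apply: ccontM; first exact: ccont_const.
by apply: ccont_prod => i; apply: cM.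
Qed.

(** Cramer's rule: each entry of the inverse is a cofactor over the determinant. *)
Lemma ccont_invmx n (M : R -> 'M[RC]_n) x :
  (forall t, M t \in unitmx) -> (forall i j, ccont (fun t => M t i j) x) ->
  forall i j, ccont (fun t => invmx (M t) i j) x.
Proof.
move=> uM cM i j.
apply: (ccont_ext (F := fun t => (\det (M t))^-1 * cofactor (M t) j i)).
  by move=> t; rewrite /invmx uM !mxE.
apply: ccontM.
  apply: ccontV; last exact: ccont_det.
  by rewrite -unitfE -unitmxE.
apply: ccontM; first exact: ccont_const.
apply: ccont_det => k l; apply: ccont_ext (cM (lift j k) (lift i l)) => t.
by rewrite !mxE.
Qed.

End ComplexContinuity.

(** * Termwise integration, and real and imaginary parts *)

Lemma is_RInt_sum (I : Type) (s : seq I) (F : I -> R -> R) (l : I -> R) (a b : R) :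
  (forall i, is_RInt (F i) a b (l i)) ->
  is_RInt (fun x => \sum_(i <- s) F i x) a b (\sum_(i <- s) l i).
Proof.
move=> HF; elim: s => [|i s IH].
  apply: (is_RInt_ext (fun _ => R0)) => [x _|]; first by rewrite big_nil.
  rewrite big_nil; have := @is_RInt_const R_NormedModule a b R0.
  by rewrite [Hierarchy.scal _ _]Rmult_0_r.
apply: (is_RInt_ext (fun x => Rplus (F i x) (\sum_(i <- s) F i x))) => [x _|].
  by rewrite big_cons.
by rewrite big_cons; apply: (is_RInt_plus (F i)).
Qed.

Lemma is_RInt_mulr (F : R -> R) (a b l c : R) :
  is_RInt F a b l -> is_RInt (fun x => F x * c) a b (l * c).
Proof.
move=> HF; have := is_RInt_scal F a b c l HF.
rewrite [Hierarchy.scal c l]Rmult_comm; apply: is_RInt_ext => x _.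
exact: Rmult_comm.
Qed.

(** The boolean lets one argument serve both real integrals that define an entry of the mean. *)
Definition part (b : bool) (z : RC) : R := if b then complex.Re z else complex.Im z.

Lemma partD b z w : part b (z + w) = part b z + part b w.
Proof. by case: b z w => [] [? ?] [? ?]. Qed.

Lemma partZ b r z : part b (rC r * z) = r * part b z.
Proof. by case: b z => [] [? ?] /=; rewrite mul0r ?subr0 ?addr0. Qed.

(** * Entries of the geometric means *)

Section MeanEntries.
Variables (n : nat) (A B : 'M[RC]_n).
Hypotheses (hA : accretive_mx A) (hB : accretive_mx B).
Variables (i j : 'I_n) (b : bool).

Definition resolvent0 (t : R) : R := part b (invmx (pencil A B 1 (rC t)) i j).
Definition resolvent1 (t : R) : R := part b (invmx (pencil A B (rC t) 1) i j).

Lemma continuous_part_invmx_pencil (p q : R -> R) x :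
  (forall t, 0 <= p t) -> (forall t, 0 <= q t) -> (forall t, 0 < p t + q t) ->
  continuous p x -> continuous q x ->
  continuous (fun t => part b (invmx (pencil A B (rC (p t)) (rC (q t))) i j)) x.
Proof.
move=> p0 q0 pq cp cq.
have [h1 h2] : ccont (fun t => invmx (pencil A B (rC (p t)) (rC (q t))) i j) x.
  apply: ccont_invmx => [t | k l]; first exact: unitmx_rpencil.
  apply: (ccont_ext (F := fun t => rC (p t) * invmx A k l + rC (q t) * invmx B k l)).
    by move=> t; rewrite !mxE.
  by apply: ccontD; apply: ccontM; do ?exact: ccont_const; split => //;
    exact: continuous_const.
by case: b.
Qed.

Lemma continuous_resolvent0_sq x : continuous (fun t => resolvent0 (pow t 2)) x.
Proof.
apply: (continuous_part_invmx_pencil (p := fun _ => 1) (q := fun t => pow t 2)).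
- by move=> t; exact: ler01.
- by move=> t; rewrite RpowE sqr_ge0.
- by move=> t; rewrite RpowE ltr_wpDr ?sqr_ge0 ?ltr01.
- exact: continuous_const.
- by apply: (@ex_derive_continuous R_AbsRing R_NormedModule); auto_derive.
Qed.

Lemma continuous_resolvent1_sq x : continuous (fun t => resolvent1 (pow t 2)) x.
Proof.
apply: (continuous_part_invmx_pencil (p := fun t => pow t 2) (q := fun _ => 1)).
- by move=> t; rewrite RpowE sqr_ge0.
- by move=> t; exact: ler01.
- by move=> t; rewrite RpowE ltr_wpDl ?sqr_ge0 ?ltr01.
- by apply: (@ex_derive_continuous R_AbsRing R_NormedModule); auto_derive.
- exact: continuous_const.
Qed.

(** The relation [fg] of the quadrature lemmas, obtained by pulling [t] out of the pencil. *)
Lemma resolvent_recip (t : R) : Rlt 0 t ->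
  resolvent0 t = Rdiv (resolvent1 (Rinv t)) t.
Proof.
move=> /RltP t0; have tn0 : t != 0 by rewrite gt_eqF.
have ti0 : 0 <= t^-1 by rewrite invr_ge0 ltW.
have u : pencil A B (rC t)^-1 1 \in unitmx.
  rewrite -rCV //; apply: (unitmx_rpencil hA hB ti0 ler01).
  by rewrite ltr_wpDl.
rewrite /resolvent0 invmx_pencil_recip ?rC_neq0 // -rCV // mxE partZ.
by rewrite /resolvent1 RdivE RinvE mulrC.
Qed.

(** The common value of the integrals for both means, before the factor [sin (PI / 2) / PI]. *)
Definition gmean_entry : R := Rplus (sq_prim resolvent0 1) (sq_prim resolvent1 1).

Lemma improper_int_resolvent (h : R -> R) :
  (forall t, Rlt 0 t -> h t = Rmult (Rinv (sqrt t)) (resolvent0 t)) ->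
  improper_int_0_inf h gmean_entry.
Proof.
apply: improper_int_inv_sqrt.
- exact: continuous_resolvent0_sq.
- exact: continuous_resolvent1_sq.
- exact: resolvent_recip.
Qed.

Lemma improper_int_resolvent_means (h : R -> R) :
  (forall t, Rlt 0 t -> h t = Rmult (Rinv (sqrt t)) (part b
     (invmx (invmx (rC 2^-1 *: (A + B)) +
             rC t *: (rC 2^-1 *: (invmx A + invmx B))) i j))) ->
  improper_int_0_inf h gmean_entry.
Proof.
move=> hE; apply: improper_int_double_angle.
- exact: continuous_resolvent0_sq.
- exact: continuous_resolvent1_sq.
move=> t t0 v s; rewrite hE //; congr Rmult.
have v1 : Rlt 1 v by rewrite -[X in Rlt X _]sqrt_1; apply: sqrt_lt_1; Lra.lra.
(* Puts the integrand in the form to which the partial fraction identity applies. *)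
have -> : t = v ^+ 2 - 1.
  rewrite -RpowE /v /= ; change (t = Rminus (pow v 2) 1).
  rewrite pow2_sqrt; Lra.lra.
rewrite (invmx_rpencil_means hA hB) ?mxE ?partZ ?partD; last exact/RltP.
exact: erefl.
Qed.

(** A single proper integral over [[0, 1]], through which positivity can be passed. *)
Lemma is_RInt_gmean_entry :
  is_RInt (fun x => Rmult 2 (Rplus (resolvent0 (pow x 2)) (resolvent1 (pow x 2)))) 0 1
    gmean_entry.
Proof.
apply: (is_RInt_ext (fun x => Rplus (Rmult 2 (resolvent0 (pow x 2)))
                                    (Rmult 2 (resolvent1 (pow x 2))))).
  by move=> x _; rewrite Rmult_plus_distr_l.
apply: (is_RInt_plus (fun x => Rmult 2 (resolvent0 (pow x 2)))).
  apply/(@RInt_correct R_CompleteNormedModule)/(@ex_RInt_continuous R_CompleteNormedModule).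
  by move=> x _; apply/continuous_scaled_sq/continuous_resolvent0_sq.
apply/(@RInt_correct R_CompleteNormedModule)/(@ex_RInt_continuous R_CompleteNormedModule).
by move=> x _; apply/continuous_scaled_sq/continuous_resolvent1_sq.
Qed.

End MeanEntries.

(** * The means as matrices, their equality and the sign of the real part *)

Section MeanMatrices.
Variable n : nat.
Implicit Types (A B : Mat).
Local Notation mx := (mx n).

Lemma part_gm_integrand A B t (i j : 'I_n) b :
  accretive_mx (mx A) -> accretive_mx (mx B) -> Rlt 0 t ->
  part b (toC (gm_integrand n (Rdiv 1 2) A B t i j)) =
  Rmult (Rinv (sqrt t)) (part b (invmx (invmx (mx A) + rC t *: invmx (mx B)) i j)).
Proof.
move=> hA hB t0; have /RltP t0' := t0.
have -> : toC (gm_integrand n (Rdiv 1 2) A B t i j) =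
    mx (gm_integrand n (Rdiv 1 2) A B t) i j by rewrite mxE.
have EP : pencil (mx A) (mx B) (rC 1) (rC t) = invmx (mx A) + rC t *: invmx (mx B).
  by rewrite /pencil rC1 scale1r.
have u : invmx (mx A) + rC t *: invmx (mx B) \in unitmx.
  by rewrite -EP; apply: unitmx_rpencil; rewrite ?ler01 ?ltW // addr_gt0.
have E : mx (madd (minv n A) (mscalR t (minv n B))) =
    invmx (mx A) + rC t *: invmx (mx B).
  by rewrite mx_add mx_scalR !mx_inv ?accretive_mx_unit.
rewrite /gm_integrand mx_scalR mxE partZ mx_inv E // RmultE; congr (_ * _).
(* The weight [t^(lam - 1)] at [lam = 1/2] is [1 / sqrt t]. *)
have -> : Rminus (Rdiv 1 2) 1 = Ropp (Rinv 2) by Lra.lra.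
by rewrite Rpower_Ropp Rpower_sqrt.
Qed.

Definition gmean_mx (A B : 'M[RC]_n) : 'M[RC]_n := \matrix_(i, j)
  (rC (Rdiv (sin (Rmult (Rdiv 1 2) PI)) PI) *
   complex.Complex (gmean_entry A B i j true) (gmean_entry A B i j false)).

(** Uniqueness of improper integrals identifies the values chosen by [epsilon]. *)
Lemma mgmean_entries A B (g : 'M[RC]_n) :
  (forall i j : 'I_n,
    improper_int_0_inf (fun t => Cre (gm_integrand n (Rdiv 1 2) A B t i j))
      (complex.Re (g i j)) /\
    improper_int_0_inf (fun t => Cim (gm_integrand n (Rdiv 1 2) A B t i j))
      (complex.Im (g i j))) ->
  mx (mgmean n A B) = rC (Rdiv (sin (Rmult (Rdiv 1 2) PI)) PI) *: g.
Proof.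
move=> H; apply/matrixP => i j; rewrite !mxE /mgmean /mgmean_w.
have [/int_0_inf_eq -> /int_0_inf_eq ->] := H i j.
by case: (g i j) => a b; apply/eqP; rewrite eq_complex /= !mul0r subr0 addr0 !eqxx.
Qed.

Lemma mx_mgmean A B : accretive_mx (mx A) -> accretive_mx (mx B) ->
  mx (mgmean n A B) = gmean_mx (mx A) (mx B).
Proof.
move=> hA hB.
rewrite (@mgmean_entries _ _ (\matrix_(i, j) complex.Complex
  (gmean_entry (mx A) (mx B) i j true) (gmean_entry (mx A) (mx B) i j false))).
  by apply/matrixP => i j; rewrite !mxE.
move=> i j; rewrite mxE /=; split; apply: improper_int_resolvent => // t t0.
  rewrite /resolvent0 /pencil scale1r; exact: (part_gm_integrand i j true hA hB t0).
rewrite /resolvent0 /pencil scale1r; exact: (part_gm_integrand i j false hA hB t0).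
Qed.

Lemma mx_mamean A B : mx (mamean A B) = rC 2^-1 *: (mx A + mx B).
Proof. by rewrite mx_scalR mx_add halfE. Qed.

Lemma accretive_mx_half_sum (X Y : 'M[RC]_n) : accretive_mx X -> accretive_mx Y ->
  accretive_mx (rC 2^-1 *: (X + Y)).
Proof.
move=> hX hY; rewrite scalerDr; apply: accretive_mx_comb => //.
- by rewrite invr_ge0 ler0n.
- by rewrite invr_ge0 ler0n.
- by rewrite addr_gt0 // invr_gt0 ltr0n.
Qed.

Lemma mx_mhmean A B : accretive_mx (mx A) -> accretive_mx (mx B) ->
  mx (mhmean n A B) = invmx (rC 2^-1 *: (invmx (mx A) + invmx (mx B))).
Proof.
move=> hA hB; have uA := accretive_mx_unit hA; have uB := accretive_mx_unit hB.
have E : mx (mscalR (Rdiv 1 2) (madd (minv n A) (minv n B))) =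
    rC 2^-1 *: (invmx (mx A) + invmx (mx B)).
  by rewrite mx_scalR mx_add !mx_inv // halfE.
rewrite /mhmean mx_inv E //; apply/accretive_mx_unit/accretive_mx_half_sum;
  exact: accretive_mx_inv.
Qed.

(** Together with [mx_mgmean] this is [(A nabla B) # (A ! B) = A # B]. Both means are again
    accretive, and [(A ! B)^-1] is the average of the inverses. *)
Lemma mx_mgmean_means A B : accretive_mx (mx A) -> accretive_mx (mx B) ->
  mx (mgmean n (mamean A B) (mhmean n A B)) = gmean_mx (mx A) (mx B).
Proof.
move=> hA hB.
have hC : accretive_mx (mx (mamean A B)).
  by rewrite mx_mamean; apply: accretive_mx_half_sum.
have hD : accretive_mx (mx (mhmean n A B)).
  rewrite mx_mhmean //; apply/accretive_mx_inv/accretive_mx_half_sum;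
    exact: accretive_mx_inv.
rewrite (@mgmean_entries _ _ (\matrix_(i, j) complex.Complex
  (gmean_entry (mx A) (mx B) i j true) (gmean_entry (mx A) (mx B) i j false))).
  by apply/matrixP => i j; rewrite !mxE.
move=> i j; rewrite mxE /=; split; apply: improper_int_resolvent_means => // t t0.
  have := part_gm_integrand i j true hC hD t0.
  by rewrite mx_mamean mx_mhmean // invmxK.
have := part_gm_integrand i j false hC hD t0.
  by rewrite mx_mamean mx_mhmean // invmxK.
Qed.

Lemma rdot_gmean_mx_ge0 (A B : 'M[RC]_n) (v : 'cV[RC]_n) :
  accretive_mx A -> accretive_mx B -> 0 <= rdot (gmean_mx A B *m v) v.
Proof.
move=> hA hB.
set M := fun x : R => invmx (pencil A B 1 (rC (pow x 2))) +
                      invmx (pencil A B (rC (pow x 2)) 1).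
set g : 'M[RC]_n := \matrix_(i, j) complex.Complex
  (gmean_entry A B i j true) (gmean_entry A B i j false).
have -> : gmean_mx A B = rC (Rdiv (sin (Rmult (Rdiv 1 2) PI)) PI) *: g.
  by apply/matrixP => i j; rewrite !mxE.
rewrite -scalemxAl rdotZl mulr_ge0 //.
  apply/RleP; have -> : Rmult (Rdiv 1 2) PI = Rdiv PI 2 by Lra.lra.
  rewrite sin_PI2; apply: Rdiv_le_0_compat; first by Lra.lra.
  exact: PI_RGT_0.
(* For fixed [v] the form is linear in the entries, so it commutes with the integral. *)
have I : is_RInt (fun x => rdot (rC 2 *: M x *m v) v) 0 1 (rdot (g *m v) v).
  apply: (is_RInt_ext (fun x => \sum_i \sum_j
   (complex.Re ((rC 2 *: M x) i j) * (complex.Re (v j 0) * complex.Re (v i 0) +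
                          complex.Im (v j 0) * complex.Im (v i 0)) +
    complex.Im ((rC 2 *: M x) i j) * (complex.Re (v j 0) * complex.Im (v i 0) -
                          complex.Im (v j 0) * complex.Re (v i 0))))).
    by move=> x _; rewrite rdot_mulmx.
  rewrite rdot_mulmx; apply: is_RInt_sum => i; apply: is_RInt_sum => j.
  have H b : is_RInt (fun x => part b ((rC 2 *: M x) i j)) 0 1 (part b (g i j)).
    have := @is_RInt_gmean_entry n A B hA hB i j b.
    have -> : gmean_entry A B i j b = part b (g i j) by rewrite mxE; case: b.
    by apply: is_RInt_ext => x _; rewrite mxE partZ mxE partD.
  exact: (@is_RInt_plus R_NormedModule _ _ _ _ _ _
    (is_RInt_mulr (H true)) (is_RInt_mulr (H false))).
apply/RleP; apply: (is_RInt_ge_0 _ _ _ _ _ I) => [|x _]; first by Lra.lra.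
have x0 : 0 <= pow x 2 :> R by rewrite RpowE sqr_ge0.
apply/RleP; rewrite -scalemxAl rdotZl mulmxDl rdotDl mulr_ge0 ?addr_ge0 //.
- exact: (rdot_invmx_pencil_ge0 hA hB v ler01 x0 (ltr_wpDr x0 ltr01)).
- exact: (rdot_invmx_pencil_ge0 hA hB v x0 ler01 (ltr_wpDl x0 ltr01)).
Qed.

(** * The Loewner order as a comparison of quadratic forms *)

Lemma loewner_leP (X Y : Mat) : hermitian n X -> hermitian n Y ->
  (forall x, Rle (rdot (mx X *m cv n x) (cv n x)) (rdot (mx Y *m cv n x) (cv n x))) ->
  loewner_le n X Y.
Proof.
move=> hX hY XY; split.
  move=> i j hi hj; rewrite /msub /madj /= (hX i j hi hj) (hY i j hi hj) /madj.
  by case: (X j i) (Y j i) => [a b] [c d]; congr pair => /=; Lra.lra.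
move=> x; rewrite Cre_cinner cv_mvmul.
have -> : mx (msub Y X) = mx Y + rC (- 1) *: mx X.
  apply/matrixP => i j; rewrite !mxE; apply/eqP; rewrite eq_complex /=.
  by rewrite !Rops_mcE !mulN1r !mul0r !subr0 !addr0 !eqxx.
rewrite mulmxDl -scalemxAl rdotDl rdotZl mulN1r; apply/RleP; rewrite subr_ge0.
exact/RleP.
Qed.

Lemma hermitian_ReM (G : Mat) : hermitian n (Defs.ReM G).
Proof.
move=> i j _ _; rewrite /Defs.ReM /mscalR /madd /madj /CscalR /Cadd /Cconj /=.
by congr pair; Lra.lra.
Qed.

Lemma hermitian_mscalR c (X : Mat) : hermitian n X -> hermitian n (mscalR c X).
Proof.
move=> hX i j hi hj; rewrite /mscalR (hX i j hi hj) /madj /CscalR /Cconj /=.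
by congr pair; Lra.lra.
Qed.

Lemma rdot_ReM (G : Mat) (x : Vec) :
  rdot (mx (Defs.ReM G) *m cv n x) (cv n x) = rdot (mx G *m cv n x) (cv n x).
Proof. by rewrite -!cv_mvmul -!Cre_cinner Cre_cinner_ReM. Qed.

End MeanMatrices.

End AccretiveMeans.

(** * The two inequalities from the equality of the means *)

Theorem mainTheorem5 (n : nat) (A B : Mat) (alpha : R) :
  accretive n A -> accretive n B ->
  0 <= alpha -> alpha < PI / 2 ->
  numrange_sub n A (sector alpha) -> numrange_sub n B (sector alpha) ->
  loewner_le n
    (mscalR (cos alpha ^ 3) (ReM (mgmean n (mamean A B) (mhmean n A B))))
    (ReM (mgmean n A B)) /\
  loewner_le n
    (ReM (mgmean n A B))
    (mscalR ((/ cos alpha) ^ 2) (ReM (mgmean n (mamean A B) (mhmean n A B)))).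
Proof.
move=> /accretive_mxP hA /accretive_mxP hB a0 a1 _ _.
have q0 x := rdot_gmean_mx_ge0 (cv n x) hA hB.
(* From [0 < cos alpha <= 1] follow [cos alpha ^ 3 <= 1] and [1 <= (/ cos alpha) ^ 2]. *)
have c0 : Rlt 0 (cos alpha) by apply: cos_gt_0; lra.
have [_ c1] := COS_bound alpha.
have hH G : hermitian n (ReM G) by apply: hermitian_ReM.
have hZ c G : hermitian n (mscalR c (ReM G)) by apply: hermitian_mscalR.
split; [apply: loewner_leP (hZ _ _) (hH _) _ | apply: loewner_leP (hH _) (hZ _ _) _] => x;
  rewrite mx_scalR -scalemxAl rdotZl !rdot_ReM (mx_mgmean_means hA hB) (mx_mgmean hA hB);
  (* Both sides now involve the same number [q >= 0], the form of [A # B] at [x]. *)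
  move/RleP: (q0 x); move: (rdot _ _) => q q0'; rewrite -RmultE.
- rewrite -[X in _ <= X]Rmult_1_l; apply: Rmult_le_compat_r => //.
  rewrite -(pow1 3); apply: pow_incr; lra.
- rewrite -[X in X <= _]Rmult_1_l; apply: Rmult_le_compat_r => //.
  rewrite -(pow1 2); apply: pow_incr; split; first by lra.
  rewrite -Rinv_1; apply: Rinv_le_contravar; lra.
Qed.
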